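(* Let $E$ and $F$ be Banach lattices such that the Fremlin projective tensor product $E\widehat{\otimes}F$ is order continuous. If a net $(x_{\alpha})\subseteq E$ is $un$-convergent to $x\in E$ and a net $(y_{\beta})\subseteq F$ is $un$-convergent to $y\in F$, then the double net $(x_{\alpha}\otimes y_{\beta})_{(\alpha,\beta)}$ is $un$-convergent to $x\otimes y$ in $E\widehat{\otimes}F$.
   Context: Banach lattices are real. For Archimedean vector lattices $E,F$, the Fremlin tensor product $E\overline{\otimes}F$ is the Archimedean vector lattice containing the algebraic tensor product $E\otimes F$ as a vector subspace, generated by it as a vector lattice, such that $(x,y)\mapsto x\otimes y$ is a lattice bimorphism and every lattice bimorphism from $E\times F$ into an Archimedean vector lattice factors uniquely through a lattice homomorphism on $E\overline{\otimes}F$. For Banach lattices $E,F$, the Fremlin projective tensor product $E\widehat{\otimes}F$ is the Banach lattice obtained as the completion of $E\otimes F$ (equivalently of $E\overline{\otimes}F$, which is a norm-dense vector sublattice) under the positive projective norm $\|\cdot\|_{|\pi|}$, given on $E\overline{\otimes}F$ by $\|u\|_{|\pi|}=\inf\{\sum_{i=1}^n\|x_i\|\|y_i\| : n\in\mathbb N,\ x_i\in E_+,\ y_i\in F_+,\ |u|\le\sum_{i=1}^n x_i\otimes y_i\}$; it is a lattice norm with $\|x\otimes y\|_{|\pi|}=\|x\|\|y\|$. A Banach lattice is order continuous if every net decreasing to $0$ in order is norm convergent to $0$. A net $(x_\alpha)$ in a Banach lattice $X$ is $un$-convergent (unbounded norm convergent) to $x\in X$ if $\||x_\alpha-x|\wedge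 u\|\to 0$ for every $u\in X_+$. A double net $(x_\alpha\otimes y_\beta)$ is indexed by the pairs $(\alpha,\beta)$ with the product (coordinatewise) direction. *)

(* Defs.v *)
(* MathComp / MathComp-Analysis *)
From HB Require Import structures.
From mathcomp Require Import all_boot all_order all_algebra.
From mathcomp Require Import boolp classical_sets functions reals topology.
From mathcomp Require Import normedtype.

Set Implicit Arguments.
Unset Strict Implicit.
Unset Printing Implicit Defensive.

Import Order.TTheory GRing.Theory Num.Theory.
Import numFieldNormedType.Exports.

Local Open Scope classical_set_scope.
Local Open Scope ring_scope.

Reserved Notation "x ≼ y" (at level 70, no associativity).

(* The order is a field of this mixin instead of an Order.Lattice structure:
   HB rejects a common substructure of Num.NumDomain carrying both a norm and an
   order, or both an addition and lattice operations, that is declared after it. *)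
HB.mixin Record isVectorLattice (R : numDomainType) E of GRing.Lmodule R E := {
  vle : rel E;
  vmeet : E -> E -> E;
  vjoin : E -> E -> E;
  vle_refl : reflexive vle;
  vle_anti : antisymmetric vle;
  vle_trans : transitive vle;
  vle_meet : forall z x y : E, vle z (vmeet x y) = vle z x && vle z y;
  vjoin_le : forall z x y : E, vle (vjoin x y) z = vle x z && vle y z;
  vle_add2r : forall z x y : E, vle x y -> vle (x + z) (y + z);
  vle_scale : forall (a : R) (x : E), 0 <= a -> vle 0 x -> vle 0 (a *: x)
}.

#[short(type="vectorLatticeType")]
HB.structure Definition VectorLattice (R : numDomainType) :=
  {E of GRing.Lmodule R E & isVectorLattice R E}.

Notation "x ≼ y" := (vle x y) : ring_scope.

(* The modulus |x| of a vector lattice; the notation `|x| is the norm. *)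
Definition modulus (R : numDomainType) (E : vectorLatticeType R) (x : E) : E :=
  vjoin x (- x).

HB.mixin Record hasLatticeNorm (R : realType) E
    of VectorLattice R E & NormedModule R E := {
  lattice_norm : forall x y : E, modulus x ≼ modulus y -> `|x| <= `|y|
}.

#[short(type="banachLatticeType")]
HB.structure Definition BanachLattice (R : realType) :=
  {E of VectorLattice R E & CompleteNormedModule R E & hasLatticeNorm R E}.

Section VectorLattices.
Variable R : numDomainType.

Definition archimedean_lattice (E : vectorLatticeType R) : Prop :=
  forall x y : E, (forall n : nat, x *+ n ≼ y) -> x ≼ 0.

Definition lattice_hom (E F : vectorLatticeType R) (f : E -> F) : Prop :=
  [/\ linear f,
      {morph f : x y / vjoin x y} & {morph f : x y / vmeet x y}].

Definition vector_sublattice (E : vectorLatticeType R) (S : set E) : Prop :=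
  [/\ S 0,
      forall (a : R) x y, S x -> S y -> S (a *: x + y),
      forall x y, S x -> S y -> S (vjoin x y) &
      forall x y, S x -> S y -> S (vmeet x y)].

Definition bilinear_map (U V W : lmodType R) (c : U -> V -> W) : Prop :=
  (forall x, linear (c x)) /\ (forall y, linear (c^~ y)).

Definition lattice_bimorphism (E F G : vectorLatticeType R)
    (c : E -> F -> G) : Prop :=
  [/\ bilinear_map c,
      forall x, 0 ≼ x -> lattice_hom (c x) &
      forall y, 0 ≼ y -> lattice_hom (c^~ y)].

Definition is_algebraic_tensor (U V A : lmodType R) (t : U -> V -> A) : Prop :=
  bilinear_map t /\
  forall (W : lmodType R) (c : U -> V -> W), bilinear_map c ->
    exists! h : A -> W, linear h /\ forall x y, h (t x y) = c x y.

(* b : E * F -> G exhibits G as the Fremlin tensor product of E and F; iota is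
   the inclusion of the algebraic tensor product. E and F are meant to be
   Archimedean, which is automatic for Banach lattices. *)
Definition is_fremlin_tensor (E F G : vectorLatticeType R)
    (b : E -> F -> G) : Prop :=
  [/\ archimedean_lattice G,
      lattice_bimorphism b,
      exists (A : lmodType R) (t : E -> F -> A) (iota : A -> G),
        [/\ is_algebraic_tensor t, linear iota, injective iota,
            forall x y, iota (t x y) = b x y &
            forall S : set G, vector_sublattice S -> range iota `<=` S ->
              S = setT] &
      forall (H : vectorLatticeType R) (c : E -> F -> H),
        archimedean_lattice H -> lattice_bimorphism c ->
        exists! h : G -> H, lattice_hom h /\ forall x y, h (b x y) = c x y].

End VectorLattices.

Section FremlinProjective.
Variable R : realType.

(* The positive projective norm of u with respect to the bilinear map b. *)
Definition pos_proj_norm (E F : banachLatticeType R) (G : vectorLatticeType R)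
    (b : E -> F -> G) (u : G) : R :=
  inf [set r | exists s : seq (E * F),
    [/\ forall p, p \in s -> 0 ≼ p.1 /\ 0 ≼ p.2,
        modulus u ≼ \sum_(p <- s) b p.1 p.2 &
        r = \sum_(p <- s) `|p.1| * `|p.2|]].

(* tens : E * F -> T exhibits T as the completion of the Fremlin tensor product
   G of E and F for the positive projective norm, where j is the inclusion. *)
Definition is_fremlin_projective_tensor (E F T : banachLatticeType R)
    (tens : E -> F -> T) : Prop :=
  exists (G : vectorLatticeType R) (b : E -> F -> G) (j : G -> T),
    [/\ is_fremlin_tensor b,
        lattice_hom j /\ injective j,
        forall u : G, `|j u| = pos_proj_norm b u,
        dense (range j) &
        forall x y, tens x y = j (b x y)].

End FremlinProjective.

Record directedSet := DirectedSet {
  dir_sort :> Type;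
  dir_le : dir_sort -> dir_sort -> Prop;
  dir_refl : forall i, dir_le i i;
  dir_trans : forall i j k, dir_le i j -> dir_le j k -> dir_le i k;
  dir_inhabited : inhabited dir_sort;
  dir_ub : forall i j, exists k, dir_le i k /\ dir_le j k
}.

(* A net indexed by I is a function x on I; it converges to l when
   x i @[i --> dir_tails I] --> l. *)
Definition dir_tails (I : directedSet) : set_system I :=
  [set A | exists i, forall j, dir_le i j -> A j].

Arguments dir_tails I : clear implicits.

#[global] Instance dir_tails_filter (I : directedSet) :
  ProperFilter (dir_tails I).
Proof.
split.
  by move=> [i /(_ i (dir_refl i))].
split.
- by case: (dir_inhabited I) => i; exists i.
- move=> P Q [i Pi] [j Qj]; have [k [ik jk]] := dir_ub i j.
  by exists k => l kl; split; [apply: Pi | apply: Qj]; apply: dir_trans kl.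
- by move=> P Q PQ [i Pi]; exists i => j /Pi /PQ.
Qed.

Section ProductDirectedSet.
Variables I J : directedSet.

Let le (p q : I * J) : Prop := dir_le p.1 q.1 /\ dir_le p.2 q.2.

Let le_refl p : le p p.
Proof. by split; apply: dir_refl. Qed.

Let le_trans p q r : le p q -> le q r -> le p r.
Proof.
by move=> [pq1 pq2] [qr1 qr2]; split; [apply: dir_trans qr1 | apply: dir_trans qr2].
Qed.

Let inh : inhabited (I * J).
Proof.
by case: (dir_inhabited I) => i; case: (dir_inhabited J) => j; exists; split.
Qed.

Let ub p q : exists r, le p r /\ le q r.
Proof.
have [i [i1 i2]] := dir_ub p.1 q.1; have [j [j1 j2]] := dir_ub p.2 q.2.
by exists (i, j).
Qed.

Definition prod_directed : directedSet :=
  DirectedSet le_refl le_trans inh ub.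

End ProductDirectedSet.

Section Convergence.
Variables (R : realType) (X : banachLatticeType R).

Definition un_cvg (I : directedSet) (x : I -> X) (l : X) : Prop :=
  forall u : X, 0 ≼ u ->
    `|vmeet (modulus (x i - l)) u| @[i --> dir_tails I] --> (0 : R).

Definition order_continuous : Prop :=
  forall (I : directedSet) (x : I -> X),
    (forall i j, dir_le i j -> x j ≼ x i) ->
    (forall i, 0 ≼ x i) -> (forall z, (forall i, z ≼ x i) -> z ≼ 0) ->
    x i @[i --> dir_tails I] --> (0 : X).

End Convergence.

Arguments order_continuous {R} X.

(* Main.v *)
(** Put [a = |x_i - x|] and [b = |y_j - y|]. Then [|x_i ⊗ y_j - x ⊗ y|] is at
    most [a ⊗ b + a ⊗ |y| + |x| ⊗ b], and elements [u ⊗ v] with [u, v >= 0]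
    dominate every element of the tensor product up to a small error in norm.
    So it is enough to bound the meet of each of the three terms with [u ⊗ v].
    For the first one, the inequality
    [min(ab, uv) <= 2 min(a, u) v + u min(b, v)] between nonnegative reals has
    a purely lattice-theoretic counterpart. Hence all the bounds are controlled
    by [|a ∧ u|] and [|b ∧ v|], which tend to 0. *)
Require Import Defs.
From HB Require Import structures.
From mathcomp Require Import all_boot all_order all_algebra.
From mathcomp Require Import boolp classical_sets functions reals topology.
From mathcomp Require Import normedtype.

Set Implicit Arguments.
Unset Strict Implicit.
Unset Printing Implicit Defensive.

Import Order.TTheory GRing.Theory Num.Theory.
Import numFieldNormedType.Exports.

Local Open Scope classical_set_scope.
Local Open Scope ring_scope.

(** * Order arithmetic and the modulus in a vector lattice *)

Section VectorLatticeTheory.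
Variables (R : numDomainType) (E : vectorLatticeType R).
Implicit Types x y z w : E.

Lemma vlexx x : x ≼ x. Proof. exact: vle_refl. Qed.

Lemma vle_le_trans x y z : x ≼ y -> y ≼ z -> x ≼ z.
Proof. exact: vle_trans. Qed.

Lemma vmeet_lel x y : vmeet x y ≼ x.
Proof. by have := vlexx (vmeet x y); rewrite vle_meet => /andP[]. Qed.

Lemma vmeet_ler x y : vmeet x y ≼ y.
Proof. by have := vlexx (vmeet x y); rewrite vle_meet => /andP[]. Qed.

Lemma vjoin_gel x y : x ≼ vjoin x y.
Proof. by have := vlexx (vjoin x y); rewrite vjoin_le => /andP[]. Qed.

Lemma vjoin_ger x y : y ≼ vjoin x y.
Proof. by have := vlexx (vjoin x y); rewrite vjoin_le => /andP[]. Qed.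

Lemma vmeetC x y : vmeet x y = vmeet y x.
Proof.
by apply: vle_anti; rewrite !vle_meet !(vmeet_lel, vmeet_ler).
Qed.

Lemma vle_meet2 x y z w : x ≼ z -> y ≼ w -> vmeet x y ≼ vmeet z w.
Proof.
move=> xz yw; rewrite vle_meet (vle_le_trans (vmeet_lel x y) xz).
exact: vle_le_trans (vmeet_ler x y) yw.
Qed.

Lemma vleD2r x y z : (x + z ≼ y + z) = (x ≼ y).
Proof.
by apply/idP/idP => [/(vle_add2r (- z))|]; [rewrite !addrK | apply: vle_add2r].
Qed.

Lemma vle_add x y z w : x ≼ z -> y ≼ w -> x + y ≼ z + w.
Proof.
move=> xz yw; apply: (@vle_le_trans _ (z + y)); first by rewrite vleD2r.
by rewrite ![z + _]addrC vleD2r.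
Qed.

Lemma subv_ge0 x y : (0 ≼ y - x) = (x ≼ y).
Proof. by rewrite -(vleD2r _ _ x) add0r subrK. Qed.

Lemma vle_addl x y : 0 ≼ y -> x ≼ x + y.
Proof. by move=> y0; rewrite -{1}[x]addr0 vle_add ?vlexx. Qed.

Lemma vle_addr x y : 0 ≼ y -> x ≼ y + x.
Proof. by move=> y0; rewrite addrC; apply: vle_addl. Qed.

Lemma vaddr_ge0 x y : 0 ≼ x -> 0 ≼ y -> 0 ≼ x + y.
Proof. by move=> x0 y0; rewrite -[0]addr0 vle_add. Qed.

Lemma vmeet_ge0 x y : 0 ≼ x -> 0 ≼ y -> 0 ≼ vmeet x y.
Proof. by move=> x0 y0; rewrite vle_meet x0. Qed.

Lemma vmeetDr x y z : vmeet x y + z = vmeet (x + z) (y + z).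
Proof.
apply: vle_anti; rewrite vle_meet !vleD2r vmeet_lel vmeet_ler /=.
rewrite -[X in X ≼ _](subrK z) vleD2r vle_meet.
by rewrite -(vleD2r _ x z) -(vleD2r _ y z) subrK vmeet_lel vmeet_ler.
Qed.

(** Translating by minus the meet moves the meet to 0, so the excesses of [x] and [y] over it are
    disjoint. *)
Lemma vmeetBmeet x y : vmeet (x - vmeet x y) (y - vmeet x y) = 0.
Proof. by rewrite -vmeetDr subrr. Qed.

(** By translation, the right side is the meet of [x + vmeet y z] and [z + vmeet y z]. The former is
    itself the meet of [x + y] and [z + x]; both dominate the left side. *)
Lemma vmeetDl_le x y z : 0 ≼ x -> 0 ≼ y -> 0 ≼ z ->
  vmeet (x + y) z ≼ vmeet x z + vmeet y z.
Proof.
move=> x0 y0 z0; rewrite vmeetDr vle_meet; apply/andP; split.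
  rewrite [x + vmeet y z]addrC vmeetDr [y + x]addrC.
  by apply: vle_meet2; rewrite ?vlexx ?vle_addl.
apply: vle_le_trans (vmeet_ler _ _) _.
by rewrite vle_addl // vmeet_ge0.
Qed.

Lemma modulus_le x y : (modulus x ≼ y) = (x ≼ y) && (- x ≼ y).
Proof. exact: vjoin_le. Qed.

Lemma le_modulus x : x ≼ modulus x. Proof. exact: vjoin_gel. Qed.

Lemma leN_modulus x : - x ≼ modulus x. Proof. exact: vjoin_ger. Qed.

Lemma modulusD x y : modulus (x + y) ≼ modulus x + modulus y.
Proof. by rewrite modulus_le opprD !vle_add ?le_modulus ?leN_modulus. Qed.

Lemma modulusN x : modulus (- x) = modulus x.
Proof.
rewrite /modulus opprK; apply: vle_anti.
by rewrite !vjoin_le !(vjoin_gel, vjoin_ger).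
Qed.

End VectorLatticeTheory.

Section ModulusField.
Variables (R : numFieldType) (E : vectorLatticeType R).
Implicit Types x y : E.

(** Scaling by 1/2, for which the scalars now form a field. *)
Lemma addxx_ge0 x : 0 ≼ x + x -> 0 ≼ x.
Proof.
have half0 : 0 <= 2%:R^-1 :> R by rewrite invr_ge0 ler0n.
move=> /(vle_scale _ _ half0).
by rewrite -mulr2n -[x *+ 2]scaler_nat scalerA mulVf ?scale1r ?pnatr_eq0.
Qed.

(** Twice the modulus dominates [x + (- x)], which is 0. *)
Lemma modulus_ge0 x : 0 ≼ modulus x.
Proof.
by apply: addxx_ge0; rewrite -(subrr x) vle_add ?le_modulus ?leN_modulus.
Qed.

Lemma ger0_modulus x : 0 ≼ x -> modulus x = x.
Proof.
move=> x0; apply: vle_anti; rewrite le_modulus modulus_le vlexx andbT /=.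
by rewrite -subv_ge0 opprK vaddr_ge0.
Qed.

End ModulusField.

(** * Lattice homomorphisms and lattice bimorphisms *)

Section LatticeHomTheory.
Variables (R : numDomainType) (E F : vectorLatticeType R) (f : E -> F).
Hypothesis hf : lattice_hom f.

Lemma lattice_hom_le x y : x ≼ y -> f x ≼ f y.
Proof.
case: hf => _ _ fI xy.
have -> : f x = vmeet (f x) (f y); last exact: vmeet_ler.
by rewrite -fI; congr f; apply: vle_anti; rewrite vmeet_lel vle_meet vlexx xy.
Qed.

End LatticeHomTheory.

Section LatticeBimorphismTheory.
Variables (R : numFieldType) (E F G : vectorLatticeType R) (c : E -> F -> G).
Hypothesis hc : lattice_bimorphism c.

Lemma bimorphismDl x1 x2 y : c (x1 + x2) y = c x1 y + c x2 y.
Proof.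
case: hc => -[_ lin] _ _; have := lin y 1 x1 x2.
by rewrite /= !scale1r.
Qed.

Lemma bimorphismDr x y1 y2 : c x (y1 + y2) = c x y1 + c x y2.
Proof.
case: hc => -[lin _] _ _; have := lin x 1 y1 y2.
by rewrite !scale1r.
Qed.

Lemma bimorphismBl x1 x2 y : c (x1 - x2) y = c x1 y - c x2 y.
Proof. by case: hc => -[_ lin] _ _; exact: (zmod_morphism_linear (lin y)). Qed.

Lemma bimorphismBr x y1 y2 : c x (y1 - y2) = c x y1 - c x y2.
Proof. by case: hc => -[lin _] _ _; exact: (zmod_morphism_linear (lin x)). Qed.

Lemma bimorphism0l y : c 0 y = 0.
Proof. by rewrite -(subrr (0 : E)) bimorphismBl subrr. Qed.

Lemma bimorphism0r x : c x 0 = 0.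
Proof. by rewrite -(subrr (0 : F)) bimorphismBr subrr. Qed.

Lemma bimorphismNl x y : c (- x) y = - c x y.
Proof. by rewrite -sub0r bimorphismBl bimorphism0l sub0r. Qed.

Lemma bimorphism_lel x1 x2 y : 0 ≼ y -> x1 ≼ x2 -> c x1 y ≼ c x2 y.
Proof. by case: hc => _ _ h y0; apply: (lattice_hom_le (h _ y0)). Qed.

Lemma bimorphism_ler x y1 y2 : 0 ≼ x -> y1 ≼ y2 -> c x y1 ≼ c x y2.
Proof. by case: hc => _ h _ x0; apply: (lattice_hom_le (h _ x0)). Qed.

Lemma bimorphism_ge0 x y : 0 ≼ x -> 0 ≼ y -> 0 ≼ c x y.
Proof.
move=> x0 y0; have := bimorphism_lel y0 x0.
by rewrite bimorphism0l.
Qed.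

(** Both second factors are enlarged to the positive element [vjoin z w]; with it fixed, [c]
    preserves meets in the first variable. *)
Lemma bimorphism_meetl x y z w : 0 ≼ x -> 0 ≼ y -> 0 ≼ z ->
  vmeet (c x z) (c y w) ≼ c (vmeet x y) (vjoin z w).
Proof.
move=> x0 y0 z0; have zw0 := vle_le_trans z0 (vjoin_gel z w).
have [_ _ /(_ _ zw0)[_ _ ->]] := hc.
by apply: vle_meet2; apply: bimorphism_ler; rewrite ?vjoin_gel ?vjoin_ger.
Qed.

Lemma bimorphism_meetr x y z w : 0 ≼ x -> 0 ≼ z -> 0 ≼ w ->
  vmeet (c x z) (c y w) ≼ c (vjoin x y) (vmeet z w).
Proof.
move=> x0 z0 w0; have xy0 := vle_le_trans x0 (vjoin_gel x y).
have [_ /(_ _ xy0)[_ _ ->] _] := hc.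
by apply: vle_meet2; apply: bimorphism_lel; rewrite ?vjoin_gel ?vjoin_ger.
Qed.

(** Each factor is split at the meets [a'] and [b']. Disjointness of the excesses removes the
    products that neither meet controls. *)
Lemma bimorphism_meet a u b v : 0 ≼ a -> 0 ≼ u -> 0 ≼ b -> 0 ≼ v ->
  vmeet (c a b) (c u v) ≼
    c (vmeet a u) v + c (vmeet a u) v + c u (vmeet b v).
Proof.
move=> a0 u0 b0 v0.
set a' := vmeet a u; set b' := vmeet b v.
have a'0 : 0 ≼ a' by apply: vmeet_ge0.
have b'0 : 0 ≼ b' by apply: vmeet_ge0.
have q0 : 0 ≼ a - a' by rewrite subv_ge0 vmeet_lel.
have p0 : 0 ≼ u - a' by rewrite subv_ge0 vmeet_ler.
have s0 : 0 ≼ b - b' by rewrite subv_ge0 vmeet_lel.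
have r0 : 0 ≼ v - b' by rewrite subv_ge0 vmeet_ler.
have cuv : c u v = c a' v + c (u - a') b' + c (u - a') (v - b').
  by rewrite -addrA -bimorphismDr [b' + _]addrC subrK -bimorphismDl addrC subrK.
have cab : c a b = c a' b' + c a' (b - b') + c (a - a') b.
  by rewrite -bimorphismDr [b' + _]addrC subrK -bimorphismDl addrC subrK.
have disjl : vmeet (c (a - a') b) (c (u - a') (v - b')) ≼ 0.
  by apply: vle_le_trans (bimorphism_meetl _ _ _ _) _;
    rewrite // vmeetBmeet bimorphism0l vlexx.
have disjr : vmeet (c a' (b - b')) (c (u - a') (v - b')) ≼ 0.
  by apply: vle_le_trans (bimorphism_meetr _ _ _ _) _;
    rewrite // vmeetBmeet bimorphism0r vlexx.
(* Of the three pieces of [c a b], only [c a' b'] can meet [c (u - a') (v - b')], and it lies below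
   [c a' v]. *)
have pr : vmeet (c a b) (c (u - a') (v - b')) ≼ c a' v.
  rewrite cab; apply: vle_le_trans (vmeetDl_le _ _ _) _;
    rewrite ?vaddr_ge0 ?bimorphism_ge0 //.
  rewrite -[c a' v]addr0 vle_add // -[c a' v]addr0.
  apply: vle_le_trans (vmeetDl_le _ _ _) _; rewrite ?bimorphism_ge0 //.
  rewrite vle_add //; apply: vle_le_trans (vmeet_lel _ _) _.
  by rewrite bimorphism_ler // vmeet_ler.
rewrite vmeetC cuv; apply: vle_le_trans (vmeetDl_le _ _ _) _;
  rewrite ?vaddr_ge0 ?bimorphism_ge0 //.
(* The last piece of [c u v] costs one [c a' v] by [pr]; the other two are bounded by themselves,
   giving the second [c a' v] and [c u b']. *)
rewrite addrAC; apply: vle_add; last by rewrite vmeetC.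
apply: vle_le_trans (vmeet_lel _ _) _; apply: vle_add; first exact: vlexx.
by rewrite bimorphism_lel // -subv_ge0 opprB addrC subrK.
Qed.

Lemma bimorphism_modulus x y : modulus (c x y) ≼ c (modulus x) (modulus y).
Proof.
(* [x'] is kept general so that the bound also applies to [- x], which has the same modulus. *)
have le x' : c x' y ≼ c (modulus x') (modulus y).
  (* 2 (|x||y| - xy) = (|x| - x)(|y| + y) + (|x| + x)(|y| - y) *)
  rewrite -subv_ge0; apply: addxx_ge0.
  have -> : c (modulus x') (modulus y) - c x' y
      + (c (modulus x') (modulus y) - c x' y)
    = c (modulus x' - x') (modulus y + y)
      + c (modulus x' + x') (modulus y - y).
    rewrite bimorphismBl bimorphismBr !bimorphismDr !bimorphismDl.
    rewrite addrACA -opprD [RHS]addrACA -opprD.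
    rewrite [X in _ = X - _]addrACA [X in _ = _ - X]addrACA.
    by rewrite [c x' (modulus y) + _]addrC [in RHS]opprD [RHS]addrA addrK.
  have m0 (V : vectorLatticeType R) (z : V) : 0 ≼ modulus z + z.
    by rewrite -[z in _ + z]opprK subv_ge0 leN_modulus.
  by rewrite vaddr_ge0 // bimorphism_ge0 ?m0 ?subv_ge0 ?le_modulus.
by rewrite modulus_le le /= -bimorphismNl -(modulusN x) le.
Qed.

(** Expanding around [x2] and [y2] leaves only differences and these fixed elements: a
    [un]-convergent net may be unbounded in norm. *)
Lemma bimorphism_modulusB x1 x2 y1 y2 :
  modulus (c x1 y1 - c x2 y2) ≼
    c (modulus (x1 - x2)) (modulus (y1 - y2))
    + c (modulus (x1 - x2)) (modulus y2) + c (modulus x2) (modulus (y1 - y2)).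
Proof.
have -> : c x1 y1 - c x2 y2 =
    c (x1 - x2) (y1 - y2) + c (x1 - x2) y2 + c x2 (y1 - y2).
  by rewrite -bimorphismDr subrK bimorphismBl bimorphismBr addrA subrK.
apply: vle_le_trans (modulusD _ _) _; rewrite vle_add ?bimorphism_modulus //.
by apply: vle_le_trans (modulusD _ _) _; rewrite vle_add ?bimorphism_modulus.
Qed.

End LatticeBimorphismTheory.

(** * Monotonicity of the lattice norm *)

Section BanachLatticeTheory.
Variables (R : realType) (X : banachLatticeType R).

Lemma ler0_lattice_norm (x y : X) :
  0 ≼ x -> x ≼ y -> `|x| <= `|y|.
Proof.
move=> x0 xy; apply: lattice_norm.
by rewrite !ger0_modulus // (vle_le_trans x0).
Qed.

Lemma norm_modulus (x : X) : `|modulus x| = `|x|.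
Proof.
have mm : modulus (modulus x) = modulus x by rewrite ger0_modulus ?modulus_ge0.
by apply/eqP; rewrite eq_le !lattice_norm // mm vlexx.
Qed.

End BanachLatticeTheory.

(** * Domination and norm estimates in the projective tensor product *)

Section FremlinProjectiveTheory.
Variables (R : realType) (E F T : banachLatticeType R) (tens : E -> F -> T).
Hypothesis hT : is_fremlin_projective_tensor tens.

Lemma tens_bimorphism : lattice_bimorphism tens.
Proof.
have [G [b [j [[_ [[bl br] bx by_] _ _] [[jl jU jI] _] _ _ tE]]]] := hT.
have lhx x : lattice_hom (b x) -> lattice_hom (tens x).
  case=> fl fU fI; split=> [a u v|u v|u v];
    by rewrite !tE ?fl ?jl ?fU ?jU ?fI ?jI.
have lhy y : lattice_hom (b^~ y) -> lattice_hom (tens^~ y).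
  case=> fl fU fI; split=> [a u v|u v|u v]; rewrite !tE.
  - by rewrite -jl; congr j; apply: fl.
  - by rewrite -jU; congr j; apply: fU.
  - by rewrite -jI; congr j; apply: fI.
split; last 2 first.
- by move=> x /bx /lhx.
- by move=> y /by_ /lhy.
split=> [x a u v|y a u v]; rewrite !tE -jl; congr j; [exact: bl | exact: br].
Qed.

Lemma tens_norm_le (x : E) (y : F) :
  0 ≼ x -> 0 ≼ y -> `|tens x y| <= `|x| * `|y|.
Proof.
have [G [b [j [[_ hb _ _] _ nj _ tE]]]] := hT => x0 y0.
rewrite tE nj; apply: ge_inf.
  (* An infimum lies below a member only if the set is bounded below, here by 0; the member is the
     value of a one-term sum. *)
  exists 0 => _ [s [_ _ ->]]; apply: sumr_ge0 => p _.
  by rewrite mulr_ge0.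
exists [:: (x, y)]; rewrite !big_seq1; split => //.
  by move=> p; rewrite inE => /eqP ->.
by rewrite ger0_modulus ?vlexx // bimorphism_ge0.
Qed.

(** Take for [u] and [v] the sums of all first and of all second factors: the extra cross terms are
    positive. *)
Lemma sum_bimorphism_le (G : vectorLatticeType R) (b : E -> F -> G)
    (s : seq (E * F)) :
  lattice_bimorphism b -> (forall p, p \in s -> 0 ≼ p.1 /\ 0 ≼ p.2) ->
  exists u v, [/\ 0 ≼ u, 0 ≼ v & \sum_(p <- s) b p.1 p.2 ≼ b u v].
Proof.
move=> hb; elim: s => [|[x y] s IHs] s0.
  by exists 0, 0; rewrite big_nil bimorphism0l ?vlexx.
have [|u [v [u0 v0 suv]]] := IHs.
  by move=> p ps; apply: s0; rewrite inE ps orbT.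
have [/= x0 y0] := s0 _ (mem_head _ _).
exists (x + u), (y + v); rewrite !vaddr_ge0 //; split=> //.
rewrite big_cons /= bimorphismDl // vle_add //.
  by rewrite bimorphism_ler // vle_addl.
by apply: vle_le_trans suv _; rewrite bimorphism_ler // vle_addr.
Qed.

(** By density some [j g] is close to [w]; [g] lies below a finite sum of elementary tensors, hence
    below one, and [r] is the modulus of the error. *)
Lemma tens_dominating (w : T) (e : R) : 0 < e ->
  exists (u : E) (v : F) (r : T),
    [/\ 0 ≼ u, 0 ≼ v, 0 ≼ r, `|r| < e & w ≼ r + tens u v].
Proof.
move=> e0.
have [G [b [j [[_ hb _ _] [hj jinj] nj dj tE]]]] := hT.
have [z [wg [g _ gE]]] : ball w e `&` range j !=set0.
  by apply: dj; [exists w; apply: ballxx | apply: ball_open].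
rewrite -gE -ball_normE /= in wg.
have [s [s0 gs]] : exists s : seq (E * F),
    (forall p, p \in s -> 0 ≼ p.1 /\ 0 ≼ p.2) /\
    modulus g ≼ \sum_(p <- s) b p.1 p.2.
  (* The infimum of the empty set is 0: if [g] were not dominated, its norm
     would be 0, so that [g = 0], which is dominated by the empty sum. *)
  apply: contrapT => noS.
  have g0 : g = 0.
    apply: jinj; have [lj _ _] := hj.
    rewrite -(subrr (0 : G)) (zmod_morphism_linear lj) subrr.
    apply/eqP; rewrite -normr_eq0 nj /pos_proj_norm.
    rewrite (_ : [set r | _] = set0) ?inf0 //.
    by rewrite -subset0 => r [s [s0 gs _]]; apply: noS; exists s.
  by apply: noS; exists [::]; rewrite big_nil g0 ger0_modulus ?vlexx.
have [u [v [u0 v0 suv]]] := sum_bimorphism_le hb s0.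
exists u, v, (modulus (w - j g)); rewrite modulus_ge0 norm_modulus; split=> //.
rewrite -[X in X ≼ _](subrK (j g)) vle_add ?le_modulus //.
rewrite tE; apply: lattice_hom_le => //.
by apply: vle_le_trans (le_modulus _) _; apply: vle_le_trans gs suv.
Qed.

(** With [x2] and [y2] as the limits, the coefficients of the two meets do not depend on the net
    elements [x1] and [y1]. *)
Lemma tens_meet_norm_le (x1 x2 u : E) (y1 y2 v : F) (w r : T) :
  0 ≼ u -> 0 ≼ v -> 0 ≼ w -> 0 ≼ r -> w ≼ r + tens u v ->
  `|vmeet (modulus (tens x1 y1 - tens x2 y2)) w| <= `|r|
    + `|vmeet (modulus (x1 - x2)) u| * (`|v| + `|v| + `|vjoin (modulus y2) v|)
    + `|vmeet (modulus (y1 - y2)) v| * (`|u| + `|vjoin (modulus x2) u|).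
Proof.
move=> u0 v0 w0 r0 wle; have hb := tens_bimorphism.
have tge0 := bimorphism_ge0 hb; have mge0 := modulus_ge0.
set z := modulus (_ - _); set a := modulus (x1 - x2).
set b := modulus (y1 - y2); set yv := vjoin _ v; set xu := vjoin _ u.
have [z0 a0 b0] : [/\ 0 ≼ z, 0 ≼ a & 0 ≼ b] by rewrite !mge0.
have xu0 : 0 ≼ xu by apply: vle_le_trans u0 (vjoin_ger _ _).
have yv0 : 0 ≼ yv by apply: vle_le_trans v0 (vjoin_ger _ _).
have au0 : 0 ≼ vmeet a u by apply: vmeet_ge0.
have bv0 : 0 ≼ vmeet b v by apply: vmeet_ge0.
(* The first three summands bound the product of the two differences; the other two bound the mixed
   terms. *)
set t := tens (vmeet a u) v + tens (vmeet a u) v + tens u (vmeet b v)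
  + tens (vmeet a u) yv + tens xu (vmeet b v).
have zw : vmeet z w ≼ r + t.
  apply: (@vle_le_trans _ _ _ (vmeet (r + tens u v) z)).
    by rewrite vmeetC vle_meet2 ?vlexx.
  apply: vle_le_trans (vmeetDl_le _ _ _) _; rewrite ?tge0 //.
  rewrite vle_add ?vmeet_lel //.
  apply: (@vle_le_trans _ _ _ (vmeet (tens a b + tens a (modulus y2)
      + tens (modulus x2) b) (tens u v))).
    by rewrite vmeetC vle_meet2 ?vlexx ?bimorphism_modulusB.
  apply: vle_le_trans (vmeetDl_le _ _ _) _; rewrite ?vaddr_ge0 ?tge0 //.
  apply: vle_add; last exact: bimorphism_meetr.
  apply: vle_le_trans (vmeetDl_le _ _ _) _; rewrite ?tge0 //.
  by apply: vle_add; [apply: bimorphism_meet | apply: bimorphism_meetl].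
apply: le_trans (ler0_lattice_norm (vmeet_ge0 z0 w0) zw) _.
have nD (p q : T) (m n : R) : `|p| <= m -> `|q| <= n -> `|p + q| <= m + n.
  by move=> pm qn; apply: le_trans (ler_normD _ _) (lerD pm qn).
(* The bound is expanded and reordered to match the five summands of [t]. *)
rewrite -addrA nD // !mulrDr ![`|vmeet b v| * _]mulrC addrA.
rewrite [_ + _ * `|yv| + _]addrAC.
by do !apply: (nD); apply: tens_norm_le.
Qed.

End FremlinProjectiveTheory.

(** * Convergence along the product of two directed sets *)

Lemma cvg_prod_directed_fst (I J : directedSet) :
  fst @ dir_tails (prod_directed I J) --> dir_tails I.
Proof.
(* Any [j] will do to lift the tail at [i] to one at [(i, j)]. *)
move=> A [i Ai]; case: (dir_inhabited J) => j.
by exists (i, j) => -[k l] [/= ik _]; apply: Ai.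
Qed.

Lemma cvg_prod_directed_snd (I J : directedSet) :
  snd @ dir_tails (prod_directed I J) --> dir_tails J.
Proof.
move=> A [j Aj]; case: (dir_inhabited I) => i.
by exists (i, j) => -[k l] [/= _ jl]; apply: Aj.
Qed.

Theorem theorem4 (R : realType) (E F T : banachLatticeType R)
    (tens : E -> F -> T) (I J : directedSet)
    (x_ : I -> E) (x : E) (y_ : J -> F) (y : F) :
  is_fremlin_projective_tensor tens ->
  order_continuous T ->
  un_cvg x_ x ->
  un_cvg y_ y ->
  un_cvg (fun p : prod_directed I J => tens (x_ p.1) (y_ p.2)) (tens x y).
Proof.
move=> hT _ hx hy w w0; apply/cvgr0Pnorm_lt => e e0.
(* One half of [e] is spent on the remainder [r], the other on the two terms that tend to 0. *)
have e20 : 0 < e / 2 by rewrite divr_gt0.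
have [u [v [r [u0 v0 r0 re wle]]]] := tens_dominating hT w e20.
(* [C] and [D] depend only on the limits and on [u], [v], which are fixed before the indices
   vary. *)
set C := `|v| + `|v| + `|vjoin (modulus y) v|.
set D := `|u| + `|vjoin (modulus x) u|.
have limx : (fun p : prod_directed I J => `|vmeet (modulus (x_ p.1 - x)) u|)
    @ dir_tails (prod_directed I J) --> (0 : R).
  exact: cvg_comp (@cvg_prod_directed_fst I J) (hx u u0).
have limy : (fun p : prod_directed I J => `|vmeet (modulus (y_ p.2 - y)) v|)
    @ dir_tails (prod_directed I J) --> (0 : R).
  exact: cvg_comp (@cvg_prod_directed_snd I J) (hy v v0).
have lim : (fun p : prod_directed I J =>
      `|vmeet (modulus (x_ p.1 - x)) u| * C
      + `|vmeet (modulus (y_ p.2 - y)) v| * D)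
    @ dir_tails (prod_directed I J) --> 0 * C + 0 * D.
  exact: cvgD (cvgM limx (cvg_cst C)) (cvgM limy (cvg_cst D)).
rewrite !mul0r addr0 in lim.
move/cvgr0Pnorm_lt: lim => /(_ _ e20).
apply: (@filterS _ _ (dir_tails_filter (prod_directed I J))) => p lt_p.
rewrite normr_id.
apply: le_lt_trans (tens_meet_norm_le _ _ _ _ _ _ _ _ _ wle) _ => //.
rewrite -addrA [ltRHS]splitr ltrD //.
by apply: le_lt_trans lt_p; apply: ler_norm.
Qed.
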